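(* Let $p>7$ be a prime. Then $$\sum_{k=0}^{[p/8]}\binom{[\frac p8]}k\binom{[\frac{3p}8]}k\Big(\frac{32}{81}\Big)^k\equiv\begin{cases}\big(\frac p3\big)2a\pmod p&\text{if }p=a^2+b^2\equiv1\pmod8,\ 4\mid a-1,\\ \frac{18}7\big(\frac p3\big)a\pmod p&\text{if }p=a^2+b^2\equiv5\pmod8,\ 4\mid a-1,\\0\pmod p&\text{if }p\equiv3\pmod4,\end{cases}$$ where $a,b\in\mathbb Z$.
   Context: $[x]$ is the floor; $\big(\frac p3\big)$ is the Legendre symbol; congruences mod $p$ are among rationals with denominator coprime to $p$. *)

(* Defs.v *)
From mathcomp Require Import all_boot all_order all_algebra.

Set Implicit Arguments.
Unset Strict Implicit.
Unset Printing Implicit Defensive.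

Import Order.TTheory GRing.Theory Num.Theory.

Local Open Scope ring_scope.

(* Meaningful when q is an odd prime. *)
Definition legendre (a : int) (q : nat) : int :=
  if (q%:Z %| a)%Z then 0
  else if [exists x : 'I_q, (q%:Z %| (x : nat)%:Z ^+ 2 - a)%Z] then 1
  else -1.

(* [denq] is the denominator in lowest terms. *)
Definition pintegral (p : nat) (x : rat) : bool := coprimez (denq x) p%:Z.

(* Congruence mod p in the ring of rationals with denominator coprime to p:
   both sides belong to that ring, and p divides the reduced numerator of
   their difference. *)
Definition eqmodq (p : nat) (x y : rat) : bool :=
  [&& pintegral p x, pintegral p y & (p%:Z %| numq (x - y))%Z].

(* Main.v *)
(* The sum [S = sum 'C(n, k) 'C(N, k) w ^ k] with [n = [p/8]], [N = [3p/8]] is, modulo p, a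
   polynomial solution of a Gauss hypergeometric equation. The quadratic transformation
   [w = 4 z (1 - z)] turns it into [T z = sum 'C(m, 2k) 'C(2k, k) (z/4) ^ k] with
   [m = (p - 1)/2], up to the factor [1 - 2 z] when p = 5, 7 mod 8; both sides satisfy the same
   equation, whose solutions of degree < p are determined by their constant term. The point
   [w = 32/81] corresponds to [z = 1/9], where [6 ^ m * T z] is the coefficient of [x ^ m] in
   [(x^2 + 6 x + 1) ^ m], that is, minus the character sum of [x (x^2 + 6 x + 1)]. A 2-isogeny
   identifies this sum with that of [x^3 - x], which vanishes for p = 3 mod 4 and otherwise is
   [chi 2] times the Jacobsthal sum [phi 1] of [x^3 + x]. The latter is [- 2 a]: the second moment
   of [phi] gives [phi 1 ^ 2 + phi g ^ 2 = 4 p] for a nonresidue g, and grouping x, -x, 1/x, -1/x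
   fixes [phi 1] modulo 8. *)
Require Import Defs.
From mathcomp Require Import all_boot all_order all_algebra.
From mathcomp Require Import all_solvable all_field ring zify.

Set Implicit Arguments.
Unset Strict Implicit.
Unset Printing Implicit Defensive.

Import Order.TTheory GRing.Theory Num.Theory.

Local Open Scope ring_scope.

(** * Polynomial solutions of the Gauss hypergeometric equation *)

Section GaussEquation.

Variable F : fieldType.
Implicit Types (s q : F) (P Q G : {poly F}).

(* Annihilates [2F1(alpha, beta; 1; X)] when [s = alpha + beta + 1] and [q = alpha * beta]. *)
Definition gauss_op s q P : {poly F} :=
  'X * (1 - 'X) * P^`()^`() + (1 - s%:P * 'X) * P^`() - q%:P * P.

Lemma gauss_opB s q P Q : gauss_op s q (P - Q) = gauss_op s q P - gauss_op s q Q.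
Proof. rewrite /gauss_op !derivB; ring. Qed.

Lemma coef_gauss_op s q P k :
  (gauss_op s q P)`_k =
  k.+1%:R ^+ 2 * P`_k.+1 - (k%:R * (k%:R - 1) + s * k%:R + q) * P`_k.
Proof.
have -> : gauss_op s q P = 'X * P^`()^`() - 'X * ('X * P^`()^`())
    + P^`() - s *: ('X * P^`()) - q *: P.
  by rewrite /gauss_op -!mul_polyC; ring.
rewrite !(coefB, coefD, coefZ, coefXM, coef_deriv).
case: k => [|[|k]] /=; rewrite ?coef_deriv; ring.
Qed.

(** In the coefficient recurrence, the coefficient of index [k.+1] carries the factor [(k+1)^2],
    invertible while [k.+1 < p]. So vanishing propagates from the constant term up to the size
    bound. *)
Lemma gauss_op_eq0 p s q P :
  p \in [pchar F] -> (size P <= p)%N -> P`_0 = 0 -> gauss_op s q P = 0 -> P = 0.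
Proof.
move=> pF szP P0 opP; apply/polyP => k; rewrite coef0.
elim: k => // k IHk; case: (leqP p k.+1) => [le_pk | lt_kp].
  by rewrite nth_default // (leq_trans szP).
have := coef_gauss_op s q P k; rewrite opP coef0 IHk mulr0 subr0 => /esym/eqP.
by rewrite mulf_eq0 expf_eq0 /= -(dvdn_pcharf pF) gtnNdvd //= => /eqP.
Qed.

Local Notation w := (4%:P * 'X * (1 - 'X) : {poly F}).

Lemma deriv_w : w^`() = 4%:P * (1 - 2%:P * 'X).
Proof. rewrite !(derivM, derivB, derivN, derivC, derivX, derivD); ring. Qed.

(** Differential form of 2F1(alpha, beta; 1; 4z(1 - z)) = 2F1(2 alpha, 2 beta; 1; z) for alpha +
    beta = 1/2: the new operator is 4 times the old one composed with [w], plus a multiple of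
    [2 s - 3]. *)
Lemma gauss_op_quadratic_even s q G : 2%:R * s = 3%:R ->
  gauss_op s q G = 0 -> gauss_op 2%:R (4%:R * q) (G \Po w) = 0.
Proof.
move=> hs opG; have : gauss_op s q G \Po w = 0 by rewrite opG comp_poly0.
have hs' : 2%:P * s%:P - 3%:P = 0 :> {poly F} by rewrite -polyCM hs subrr.
rewrite /gauss_op !(comp_polyB, comp_polyD, comp_polyM, comp_polyX, comp_polyC).
rewrite !deriv_comp !derivM deriv_comp deriv_w.
rewrite !(derivM, derivB, derivN, derivC, derivX, derivD).
set G0 := G \Po w; set G2 := _^`()^`() \Po w; set G1 := _^`() \Po w.
set H := (X in X = 0) => h.
set L := (X in X = 0).
have -> : L = 4%:P * H + 2%:P * w * G1 * (2%:P * s%:P - 3%:P).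
  by rewrite /L /H; ring.
by rewrite h hs' !mulr0 addr0.
Qed.

(** Now alpha + beta = 3/2. As 1 - w = (1 - 2z)^2, Euler's transformation turns (1 - 2z) 2F1(alpha,
    beta; 1; w) into 2F1(1 - alpha, 1 - beta; 1; w), which falls under the previous case with 4 (1 -
    alpha)(1 - beta) = 4q - 2. *)
Lemma gauss_op_quadratic_odd s q G : 2%:R * s = 5%:R ->
  gauss_op s q G = 0 ->
  gauss_op 2%:R (4%:R * q - 2%:R) ((1 - 2%:P * 'X) * (G \Po w)) = 0.
Proof.
move=> hs opG; have : gauss_op s q G \Po w = 0 by rewrite opG comp_poly0.
have hs' : 2%:P * s%:P - 5%:P = 0 :> {poly F} by rewrite -polyCM hs subrr.
rewrite /gauss_op !(comp_polyB, comp_polyD, comp_polyM, comp_polyX, comp_polyC).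
rewrite !derivM !derivB !derivM !deriv_comp !derivD !derivM !deriv_comp deriv_w.
rewrite !(derivM, derivB, derivN, derivC, derivX, derivD).
set G0 := G \Po w; set G2 := _^`()^`() \Po w; set G1 := _^`() \Po w.
set H := (X in X = 0) => h.
set L := (X in X = 0); pose u : {poly F} := 1 - 2%:P * 'X.
have -> : L = 4%:P * u * H + 2%:P * u * w * G1 * (2%:P * s%:P - 5%:P).
  by rewrite /L /H /u; ring.
by rewrite h hs' !mulr0 addr0.
Qed.

End GaussEquation.

(** * The quadratic transformation and the value at 32/81 *)

Section QuadraticTransformation.

Variable F : fieldType.

Lemma natr_mul_bin_left n k :
  k.+1%:R * 'C(n, k.+1)%:R = (n%:R - k%:R) * 'C(n, k)%:R :> F.
Proof.
rewrite -natrM mul_bin_left natrM; case: (leqP k n) => [le_kn | lt_nk].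
  by rewrite natrB.
by rewrite bin_small ?mulr0.
Qed.

(** The hypergeometric polynomial 2F1(-n, -N; 1; X). *)
Definition bin_poly n N : {poly F} := \poly_(k < n.+1) ('C(n, k)%:R * 'C(N, k)%:R).

Lemma coef_bin_poly n N k : (bin_poly n N)`_k = 'C(n, k)%:R * 'C(N, k)%:R.
Proof.
by rewrite coef_poly ltnS; case: leqP => // lt_nk; rewrite bin_small ?mul0r.
Qed.

Lemma gauss_op_bin_poly n N :
  gauss_op (1 - n%:R - N%:R) (n%:R * N%:R) (bin_poly n N) = 0.
Proof.
apply/polyP => k; rewrite coef0 coef_gauss_op !coef_bin_poly.
have -> : k.+1%:R ^+ 2 * ('C(n, k.+1)%:R * 'C(N, k.+1)%:R) =
   (k.+1%:R * 'C(n, k.+1)%:R) * (k.+1%:R * 'C(N, k.+1)%:R) :> F by ring.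
by rewrite !natr_mul_bin_left; ring.
Qed.

(* [a ^ m * (trinom_poly m).[4 / a ^ 2]] is the coefficient of [x ^ m] in
   [(x ^ 2 + a x + 1) ^ m]. *)
Definition trinom_poly m : {poly F} :=
  \poly_(k < (m./2).+1) ('C(m, k.*2)%:R * 'C(k.*2, k)%:R / 4%:R ^+ k).

Lemma coef_trinom_poly m k :
  (trinom_poly m)`_k = 'C(m, k.*2)%:R * 'C(k.*2, k)%:R / 4%:R ^+ k.
Proof.
rewrite coef_poly ltnS; case: leqP => // lt_mk.
by rewrite bin_small ?mul0r //; lia.
Qed.

Lemma mul_central_bin k :
  (k.+1 ^ 2 * 'C(k.+1.*2, k.+1) = k.*2.+2 * k.*2.+1 * 'C(k.*2, k))%N.
Proof.
have h1 := mul_bin_diag k.*2.+2 k; have h2 := mul_bin_down k.*2.+1 k.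
rewrite /= in h1 h2; rewrite doubleS -mulnA h2.
have -> : (k.*2.+1 - k = k.+1)%N by lia.
by rewrite mulnCA h1 expnS expn1 mulnA.
Qed.

(** Since m = -1/2 in [F], the coefficient recurrence has the factor (k + 1/4)(k + 3/4): the
    equation is that of 2F1(1/4, 3/4; 1; X). *)
Lemma gauss_op_trinom_poly m : 2%:R != 0 :> F -> 2%:R * m%:R = -1 :> F ->
  gauss_op 2%:R (3%:R / 16%:R) (trinom_poly m) = 0.
Proof.
move=> F2 m2; apply/polyP => k; rewrite coef0 coef_gauss_op !coef_trinom_poly.
have F4 : 4%:R != 0 :> F by rewrite (natrM _ 2 2) mulf_neq0.
have F16 : 16%:R != 0 :> F by rewrite (natrM _ 4 4) mulf_neq0.
have Em : m%:R = - 1 / 2%:R :> F by apply: (mulfI F2); rewrite m2; field.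
have F4k : 4%:R ^+ k != 0 :> F by rewrite expf_neq0.
have hC : 'C(m, k.+1.*2)%:R * (k.*2.+2%:R * k.*2.+1%:R) =
   (m%:R - k.*2.+1%:R) * (m%:R - k.*2%:R) * 'C(m, k.*2)%:R :> F.
  by rewrite mulrA [_ * k.*2.+2%:R]mulrC doubleS natr_mul_bin_left -!mulrA
    -natr_mul_bin_left [X in _ * X]mulrC.
have h : k.+1%:R ^+ 2 * ('C(m, k.+1.*2)%:R * 'C(k.+1.*2, k.+1)%:R) =
    (m%:R - k.*2.+1%:R) * (m%:R - k.*2%:R) * 'C(m, k.*2)%:R * 'C(k.*2, k)%:R :> F.
  by rewrite mulrCA -natrX -natrM mul_central_bin -hC !natrM; ring.
rewrite mulrA h exprS Em -addnn; move: (4%:R ^+ k) F4k => c c0.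
by rewrite -!natr1 natrD; field; rewrite c0 F16 F4 F2.
Qed.

Local Notation w := (4%:P * 'X * (1 - 'X) : {poly F}).

Lemma size_bin_poly_comp n N : (size (bin_poly n N \Po w) <= (2 * n).+1)%N.
Proof.
have szw : (size w <= 3)%N.
  rewrite -mulrA mul_polyC (leq_trans (size_scale_leq _ _)) //.
  rewrite (leq_trans (size_polyMleq _ _)) // size_polyX ltnS.
  by rewrite (leq_trans (size_polyD _ _)) // size_polyN size_polyX size_poly1.
apply: leq_trans (size_comp_poly_leq _ _) _; rewrite ltnS mulnC leq_mul //.
  by case: (size w) szw.
have := size_poly n.+1 (fun k => 'C(n, k)%:R * 'C(N, k)%:R : F).
by rewrite -/(bin_poly n N); case: (size _).
Qed.

Lemma size_trinom_poly m : (size (trinom_poly m) <= m.+1)%N.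
Proof. by rewrite (leq_trans (size_poly _ _)) // ltnS; lia. Qed.

Lemma trinom_poly_coef0 m : (trinom_poly m)`_0 = 1.
Proof. by rewrite coef_trinom_poly !bin0 expr0 divr1 mulr1. Qed.

Lemma bin_poly_comp_coef0 n N : (bin_poly n N \Po w)`_0 = 1.
Proof.
rewrite -horner_coef0 horner_comp !hornerE ?horner_coef0.
by rewrite coef_bin_poly !bin0 mulr1.
Qed.

(** With alpha = -n and beta = -N, the hypotheses say alpha + beta = 1/2 and 4 alpha beta = 3/16, so
    both sides solve one equation; both have constant term 1. *)
Lemma trinom_poly_even p m n N : p \in [pchar F] ->
    2%:R != 0 :> F -> 2%:R * m%:R = -1 :> F ->
    2%:R * (n%:R + N%:R) = -1 :> F -> 64%:R * n%:R * N%:R = 3%:R :> F ->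
    (m < p)%N -> (2 * n < p)%N ->
  trinom_poly m = bin_poly n N \Po w.
Proof.
move=> pF F2 m2 nN1 nN2 lt_mp lt_np; apply/eqP; rewrite -subr_eq0; apply/eqP.
have F16 : 16%:R != 0 :> F by rewrite (natrX _ 2 4) expf_neq0.
apply: (gauss_op_eq0 (s := 2%:R) (q := 3%:R / 16%:R) pF).
- rewrite (leq_trans (size_polyD _ _)) // size_polyN geq_max.
  by rewrite !(leq_trans (size_trinom_poly _), leq_trans (size_bin_poly_comp _ _)).
- by rewrite coefB trinom_poly_coef0 bin_poly_comp_coef0 subrr.
rewrite gauss_opB gauss_op_trinom_poly // sub0r; apply/eqP; rewrite oppr_eq0.
have -> : 3%:R / 16%:R = 4%:R * (n%:R * N%:R) :> F by rewrite -nN2; field.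
apply/eqP/gauss_op_quadratic_even/gauss_op_bin_poly.
by rewrite -addrA -opprD mulrBr nN1; ring.
Qed.

(** Here alpha + beta = 3/2 and 4 alpha beta - 2 = 35/16 - 2 = 3/16. The factor 1 - 2z raises the
    degree by one, hence the stronger bound on [n]. *)
Lemma trinom_poly_odd p m n N : p \in [pchar F] ->
    2%:R != 0 :> F -> 2%:R * m%:R = -1 :> F ->
    2%:R * (n%:R + N%:R) = -3%:R :> F -> 64%:R * n%:R * N%:R = 35%:R :> F ->
    (m < p)%N -> ((2 * n).+1 < p)%N ->
  trinom_poly m = (1 - 2%:P * 'X) * (bin_poly n N \Po w).
Proof.
move=> pF F2 m2 nN1 nN2 lt_mp lt_np; apply/eqP; rewrite -subr_eq0; apply/eqP.
have F16 : 16%:R != 0 :> F by rewrite (natrX _ 2 4) expf_neq0.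
apply: (gauss_op_eq0 (s := 2%:R) (q := 3%:R / 16%:R) pF).
- rewrite (leq_trans (size_polyD _ _)) // size_polyN geq_max.
  rewrite (leq_trans (size_trinom_poly _)) //.
  rewrite (leq_trans (size_polyMleq _ _)) //.
  have : (size (1 - 2%:P * 'X : {poly F})%R <= 2)%N.
    rewrite (leq_trans (size_polyD _ _)) // size_poly1 size_polyN geq_max /=.
    by rewrite mul_polyC (leq_trans (size_scale_leq _ _)) // size_polyX.
  move=> le2; rewrite -subn1 leq_subLR.
  by rewrite (leq_trans (leq_add le2 (size_bin_poly_comp n N))) //; lia.
- rewrite coefB trinom_poly_coef0 coef0M bin_poly_comp_coef0.
  by rewrite coefB coef1 coefMX subr0 mulr1 subrr.
rewrite gauss_opB gauss_op_trinom_poly // sub0r; apply/eqP; rewrite oppr_eq0.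
have -> : 3%:R / 16%:R = 4%:R * (n%:R * N%:R) - 2%:R :> F.
  by rewrite (_ : 3%:R = 64%:R * n%:R * N%:R - 32%:R :> F); [field | rewrite nN2; ring].
apply/eqP/gauss_op_quadratic_odd/gauss_op_bin_poly.
by rewrite -addrA -opprD mulrBr nN1; ring.
Qed.

Lemma horner_bin_poly n N x :
  (bin_poly n N).[x] = \sum_(0 <= k < n.+1) 'C(n, k)%:R * 'C(N, k)%:R * x ^+ k.
Proof. by rewrite horner_poly big_mkord. Qed.

Lemma bin_poly_value_even p m n N : p \in [pchar F] ->
    2%:R != 0 :> F -> 3%:R != 0 :> F -> 2%:R * m%:R = -1 :> F ->
    2%:R * (n%:R + N%:R) = -1 :> F -> 64%:R * n%:R * N%:R = 3%:R :> F ->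
    (m < p)%N -> (2 * n < p)%N ->
  (bin_poly n N).[32%:R / 81%:R] = (trinom_poly m).[9%:R^-1].
Proof.
move=> pF F2 F3 m2 nN1 nN2 lt_mp lt_np.
rewrite (trinom_poly_even pF F2 m2 nN1 nN2) // horner_comp !hornerE.
have F9 : 9%:R != 0 :> F by rewrite (natrX _ 3 2) expf_neq0.
have F81 : 81%:R != 0 :> F by rewrite (natrX _ 3 4) expf_neq0.
by congr (_.[_]); field; rewrite F9.
Qed.

(** The factor 1 - 2z equals 7/9 at z = 1/9. *)
Lemma bin_poly_value_odd p m n N : p \in [pchar F] ->
    2%:R != 0 :> F -> 3%:R != 0 :> F -> 2%:R * m%:R = -1 :> F ->
    2%:R * (n%:R + N%:R) = -3%:R :> F -> 64%:R * n%:R * N%:R = 35%:R :> F ->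
    (m < p)%N -> ((2 * n).+1 < p)%N ->
  7%:R * (bin_poly n N).[32%:R / 81%:R] = 9%:R * (trinom_poly m).[9%:R^-1].
Proof.
move=> pF F2 F3 m2 nN1 nN2 lt_mp lt_np.
rewrite (trinom_poly_odd pF F2 m2 nN1 nN2) // hornerM horner_comp !hornerE.
have F9 : 9%:R != 0 :> F by rewrite (natrX _ 3 2) expf_neq0.
have F81 : 81%:R != 0 :> F by rewrite (natrX _ 3 4) expf_neq0.
have -> : 32%:R / 81%:R = 4%:R / 9%:R * (1 - 9%:R^-1) :> F by field; rewrite F9.
by rewrite /=; field.
Qed.

End QuadraticTransformation.

(** [p] divides (aB)^2 - (bA)^2, hence aB - cA for c = b or c = -b. As (aA + cB)^2 + (aB - cA)^2 =
    p^2, one of the two squares on the left is 0, and each case gives one alternative. *)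
Lemma two_squares_unique p (a b A B : int) : prime p ->
  p%:Z = a ^+ 2 + b ^+ 2 -> p%:Z = A ^+ 2 + B ^+ 2 ->
  a ^+ 2 = A ^+ 2 \/ a ^+ 2 = B ^+ 2.
Proof.
move=> p_pr Ep EP; have p0 : p%:Z != 0 by rewrite eqz_nat -lt0n prime_gt0.
have key c : p%:Z = a ^+ 2 + c ^+ 2 -> (p%:Z %| a * B - c * A)%Z ->
    a ^+ 2 = A ^+ 2 \/ a ^+ 2 = B ^+ 2.
  move=> Ec /dvdzP[k Ek].
  have Esq : (a * A + c * B) ^+ 2 + (a * B - c * A) ^+ 2 = p%:Z ^+ 2.
    by rewrite [RHS]expr2 {1}Ec EP; ring.
  have [k0 | k0] := eqVneq k 0; [left | right].
    apply: (mulfI p0); have : a * B = c * A by apply/eqP; rewrite -subr_eq0 Ek k0 mul0r.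
    move=> /(congr1 (fun x => x ^+ 2)); rewrite !exprMn => E.
    transitivity (a ^+ 2 * A ^+ 2 + a ^+ 2 * B ^+ 2); first by rewrite EP; ring.
    by rewrite E Ec; ring.
  have u0 : a * A + c * B = 0.
    apply/eqP; rewrite -sqrf_eq0; apply/eqP/le_anti; rewrite sqr_ge0 andbT.
    have -> : (a * A + c * B) ^+ 2 = p%:Z ^+ 2 * (1 - k ^+ 2).
      by apply: (addIr ((a * B - c * A) ^+ 2)); rewrite Esq Ek; ring.
    rewrite mulr_ge0_le0 ?sqr_ge0 // subr_le0.
    have : 0 < k ^+ 2 by rewrite lt0r sqrf_eq0 k0 sqr_ge0.
    by rewrite -gtz0_ge1.
  apply: (mulfI p0); apply/eqP; rewrite -subr_eq0; apply/eqP.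
  have : a * A = - (c * B) by apply/eqP; rewrite -addr_eq0 u0.
  move=> /(congr1 (fun x => x ^+ 2)); rewrite sqrrN !exprMn => E.
  have EA : A ^+ 2 = p%:Z - B ^+ 2 by rewrite EP addrK.
  have EC : c ^+ 2 = p%:Z - a ^+ 2 by rewrite Ec addrC addKr.
  transitivity (a ^+ 2 * (p%:Z - B ^+ 2) - (p%:Z - a ^+ 2) * B ^+ 2); first by ring.
  by rewrite -EA -EC E subrr.
have : (p%:Z %| (a * B - b * A) * (a * B - - b * A))%Z.
  apply/dvdzP; exists (a ^+ 2 - A ^+ 2).
  transitivity (a ^+ 2 * (A ^+ 2 + B ^+ 2) - A ^+ 2 * (a ^+ 2 + b ^+ 2)); first by ring.
  by rewrite -Ep -EP; ring.
rewrite !dvdzE abszM Euclid_dvdM // => /orP[]; first exact: key.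
by apply: key; rewrite sqrrN.
Qed.

(** * The quadratic character of a finite field of odd order, and complete sums *)

Section QuadraticCharacter.

Variables (F : finFieldType) (m : nat).
Hypotheses (cardF : #|F| = m.*2.+1) (F2 : 2%:R != 0 :> F).
Implicit Types (x y u v : F).

(** Euler's criterion taken as definition. The values are integers because the sums are later
    squared and compared over Z. *)
Definition chi x : int := if x == 0 then 0 else if x ^+ m == 1 then 1 else -1.

Lemma half_card_gt0 : (0 < m)%N.
Proof. by have := finRing_gt1 F; rewrite cardF; case: (m). Qed.

Lemma expf_card_pred x : x != 0 -> x ^+ m.*2 = 1.
Proof.
move=> x0; apply: (mulfI x0); rewrite mulr1 -exprS -cardF; exact: expf_card.
Qed.

Lemma neqN11 : (-1 == 1 :> F) = false.
Proof. by rewrite -subr_eq0 -opprD oppr_eq0 (negPf F2). Qed.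

Lemma expf_half_card x : x != 0 -> x ^+ m = 1 \/ x ^+ m = -1.
Proof.
move=> /expf_card_pred; rewrite -muln2 exprM => /eqP.
by rewrite sqrf_eq1 => /orP[]/eqP; [left | right].
Qed.

Lemma chi0 : chi 0 = 0. Proof. by rewrite /chi eqxx. Qed.

Lemma chi1 : chi 1 = 1. Proof. by rewrite /chi oner_eq0 expr1n eqxx. Qed.

Lemma chi_eq x : x != 0 -> chi x = if x ^+ m == 1 then 1 else -1.
Proof. by rewrite /chi => /negPf->. Qed.

Lemma intr_chi x : (chi x)%:~R = x ^+ m :> F.
Proof.
have [-> | x0] := eqVneq x 0; first by rewrite chi0 expr0n gtn_eqF ?half_card_gt0.
by rewrite chi_eq //; case: (expf_half_card x0) => ->; rewrite ?eqxx ?neqN11 ?mulrN1z.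
Qed.

Lemma chiM x y : chi (x * y) = chi x * chi y.
Proof.
have [-> | x0] := eqVneq x 0; first by rewrite mul0r chi0 mul0r.
have [-> | y0] := eqVneq y 0; first by rewrite mulr0 chi0 mulr0.
rewrite !chi_eq ?mulf_neq0 // exprMn.
case: (expf_half_card x0) => ->; case: (expf_half_card y0) => ->;
  by rewrite ?mulr1 ?mul1r ?mulrNN ?mulr1 ?eqxx ?neqN11.
Qed.

Lemma chi_sqr x : chi x ^+ 2 = (x != 0)%:R.
Proof. by rewrite /chi; case: eqP => //= _; case: ifP. Qed.

Lemma chi_exp2 x : x != 0 -> chi (x ^+ 2) = 1.
Proof. by move=> x0; rewrite expr2 chiM -expr2 chi_sqr x0. Qed.

Lemma prim_root_ex : {z : F | m.*2.-primitive_root z}.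
Proof.
have n0 : (0 < m.*2)%N by rewrite double_gt0 half_card_gt0.
pose rs := [seq x <- enum F | x != 0].
have h : has m.*2.-primitive_root rs.
  apply: has_prim_root => //.
  - apply/allP=> x; rewrite mem_filter => /andP[x0 _].
    by rewrite unity_rootE expf_card_pred.
  - by rewrite filter_uniq ?enum_uniq.
  have -> : rs = rem 0 (enum F) by rewrite rem_filter ?enum_uniq.
  by rewrite size_rem ?mem_enum // -cardE cardF.
by exists (nth 0 rs (find m.*2.-primitive_root rs)); exact: nth_find.
Qed.

Section Generator.

Variable z : F.
Hypothesis zP : m.*2.-primitive_root z.

Lemma prim_root_neq0 : z != 0.
Proof.
apply/eqP => z0; have := prim_expr_order zP.
by rewrite z0 expr0n double_eq0 gtn_eqF ?half_card_gt0 // => /eqP; rewrite eq_sym oner_eq0.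
Qed.

Lemma prim_root_exp_half : z ^+ m = -1.
Proof.
case: (expf_half_card prim_root_neq0) => // /eqP; rewrite -(prim_order_dvd zP).
by move=> /(dvdn_leq half_card_gt0); have := half_card_gt0; lia.
Qed.

Lemma chi_prim_rootX j : chi (z ^+ j) = (-1) ^+ j.
Proof.
elim: j => [|j IHj]; first by rewrite !expr0 chi1.
by rewrite !exprS chiM IHj chi_eq ?prim_root_neq0 // prim_root_exp_half neqN11.
Qed.

Lemma prim_root_log x : x != 0 -> exists2 j, (j < m.*2)%N & x = z ^+ j.
Proof. by move=> /expf_card_pred/(prim_rootP zP)[j ->]; exists j. Qed.

Lemma sum_prim_rootX (V : zmodType) (f : F -> V) :
  \sum_(x | x != 0) f x = \sum_(0 <= j < m.*2) f (z ^+ j).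
Proof.
rewrite -(big_map (fun j => z ^+ j) xpredT f) big_uniq /=.
  apply: eq_bigl => x; apply/idP/mapP => [/prim_root_log[j j_lt ->] | [j _ ->]].
    by exists j; rewrite ?mem_index_iota.
  by rewrite expf_neq0 ?prim_root_neq0.
rewrite map_inj_in_uniq ?iota_uniq // => i j; rewrite !mem_index_iota /=.
move=> lt_i lt_j /eqP; rewrite (eq_prim_root_expr zP) !modn_small //.
by move/eqP.
Qed.

End Generator.

Lemma sum_split0 (V : zmodType) (f : F -> V) :
  \sum_x f x = f 0 + \sum_(x | x != 0) f x.
Proof. by rewrite (bigD1 0). Qed.

Lemma sum_translate (V : zmodType) (f : F -> V) u : \sum_x f (x + u) = \sum_x f x.
Proof. by rewrite [RHS](reindex_inj (addIr u)). Qed.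

Lemma sum_dilate (V : zmodType) (f : F -> V) u : u != 0 -> \sum_x f (x * u) = \sum_x f x.
Proof. by move=> u0; rewrite [RHS](reindex_inj (mulIf u0)). Qed.

(** Dilation by a generator [z], for which [chi z = -1], negates the sum. *)
Lemma sum_chi : \sum_x chi x = 0.
Proof.
have [z zP] := prim_root_ex; have z0 := prim_root_neq0 zP.
have : \sum_x chi (x * z) = - \sum_x chi x.
  rewrite -sumrN; apply: eq_bigr => x _.
  by have := chi_prim_rootX zP 1; rewrite !expr1 chiM => ->; rewrite mulrN1.
by rewrite (sum_dilate chi z0); move: (\sum_x chi x) => s; lia.
Qed.

(** Dilation by a generator [z] multiplies the sum by [z ^+ j], which is 1 only if [m.*2] divides
    [j]; in that case every nonzero [x] contributes 1. *)
Lemma sum_power j : (0 < j)%N -> \sum_(x : F) x ^+ j = - (m.*2 %| j)%:R.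
Proof.
move=> j0; have [z zP] := prim_root_ex; have z0 := prim_root_neq0 zP.
case: (boolP (_ %| _)%N) => [/dvdnP[k Ej] | ndvd].
  rewrite sum_split0 expr0n gtn_eqF // add0r.
  transitivity (\sum_(x : F | x != 0) (1 : F)).
    by apply: eq_bigr => x x0; rewrite Ej mulnC exprM expf_card_pred // expr1n.
  (* Translating the sum of all elements by 1 shows that the cardinality is 0 in [F]. *)
  have : \sum_(x : F) (1 : F) = 0.
    have : \sum_(x : F) (x + 1) = \sum_(x : F) x by rewrite (sum_translate id).
    by rewrite big_split /= => h; apply: (addrI (\sum_(x : F) x)); rewrite h addr0.
  by rewrite sum_split0 addrC => /eqP; rewrite addr_eq0 => /eqP.
have : \sum_(x : F) (x * z) ^+ j = \sum_(x : F) x ^+ j by rewrite (sum_dilate (fun x => x ^+ j)).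
under eq_bigr do rewrite exprMn.
rewrite -mulr_suml => /eqP; rewrite -subr_eq0 -[X in _ - X]mulr1 -mulrBr.
rewrite mulf_eq0 subr_eq0 -(prim_order_dvd zP) (negPf ndvd) orbF oppr0.
by move/eqP.
Qed.

Lemma count_sqrt u : \sum_x (x ^+ 2 == u)%:R = 1 + chi u :> int.
Proof.
have [z zP] := prim_root_ex.
have [-> | u0] := eqVneq u 0.
  rewrite chi0 sum_split0 expr0n eqxx big1 ?addr0 // => x /negPf x0.
  by rewrite sqrf_eq0 x0.
have [j _ Eu] := prim_root_log zP u0; case: (boolP (odd j)) => odd_j.
  rewrite Eu (chi_prim_rootX zP) -signr_odd odd_j addrN big1 // => x _.
  case: eqP => // xE; have x0 : x != 0.
    by apply: contraNneq u0 => x0; rewrite Eu -xE x0 expr0n.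
  by have := chi_exp2 x0; rewrite xE (chi_prim_rootX zP) -signr_odd odd_j.
have Ej : (j = j./2 * 2)%N by rewrite muln2 -[LHS]odd_double_half (negPf odd_j).
rewrite Ej exprM in Eu; set y := z ^+ _ in Eu.
have y0 : y != 0 by rewrite expf_neq0 ?prim_root_neq0.
have yN : y != - y by rewrite -subr_eq0 opprK -mulr2n -mulr_natr mulf_neq0.
rewrite Eu chi_exp2 // (bigD1 y) //= eqxx (bigD1 (- y)) /=; last by rewrite eq_sym.
rewrite sqrrN eqxx big1 // => x /andP[xy xNy].
by rewrite eqf_sqr (negPf xy) (negPf xNy).
Qed.

(** After a translation the argument is x(x + c) with c = v - u. The substitution x := c/x makes it
    a nonzero square times 1 + x, and the full sum of [chi (1 + x)] vanishes, with the term 1 at x =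
    0. *)
Lemma sum_chi_mul u v : u != v -> \sum_x chi ((x + u) * (x + v)) = -1.
Proof.
move=> uv; have c0 : v - u != 0 by rewrite subr_eq0 eq_sym.
transitivity (\sum_x chi (x * (x + (v - u)))).
  rewrite -[RHS](sum_translate _ u); apply: eq_bigr => x _; congr (chi (_ * _)); ring.
move: (v - u) c0 => c c0; rewrite sum_split0 mul0r chi0 add0r.
transitivity (\sum_(x | x != 0) chi (1 + x)).
  rewrite (reindex_onto (fun x => c / x) (fun x => c / x)) /=; last first.
    by move=> x x0; field; rewrite c0 x0.
  apply: eq_big => x => [|/andP[cx0 _]].
    have [-> | x0] := eqVneq x 0; first by rewrite invr0 mulr0 eqxx.
    by rewrite mulf_neq0 ?invr_eq0 //=; apply/eqP; field; rewrite c0 x0.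
  have x0 : x != 0 by apply: contraNneq cx0 => ->; rewrite invr0 mulr0.
  have -> : c / x * (c / x + c) = (c / x) ^+ 2 * (1 + x) by field.
  by rewrite chiM chi_exp2 // mul1r.
have : \sum_x chi (1 + x) = 0.
  apply: etrans sum_chi; rewrite -[RHS](sum_translate chi 1).
  by apply: eq_bigr => x _; rewrite addrC.
by rewrite sum_split0 addr0 chi1; move: (\sum_(x | _) _) => s; lia.
Qed.

(** * Jacobsthal sums, the 2-isogeny and the trinomial coefficient *)

Definition phi u : int := \sum_x chi (x * (x ^+ 2 + u)).

(* The number of [x] with [x + 1/x = u] is [1 + chi (u ^ 2 - 4)]. *)
Lemma sum_chi_isogeny a :
  \sum_x chi (x * (x ^+ 2 + a * x + 1)) = \sum_x chi ((x + a) * (x ^+ 2 - 4%:R)).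
Proof.
have F4 : 4%:R != 0 :> F by rewrite (natrM _ 2 2) mulf_neq0.
(* For x != 0, x + 1/x = u amounts to (2x - u)^2 = u^2 - 4, and x = 0 never solves the latter
   because 4 != 0. *)
have count u : \sum_(x | x != 0) (x + x^-1 == u)%:R = 1 + chi (u ^+ 2 - 4%:R).
  rewrite -count_sqrt -(sum_translate (fun x => (x ^+ 2 == _)%:R) (- u)).
  rewrite -(sum_dilate (fun x => ((x - u) ^+ 2 == _)%:R) F2) sum_split0 mul0r sub0r.
  have -> : ((- u) ^+ 2 == u ^+ 2 - 4%:R) = false.
    by rewrite sqrrN -subr_eq0 opprB addrC subrK (negPf F4).
  rewrite add0r; apply: eq_bigr => x x0; congr (nat_of_bool _)%:R.
  rewrite -subr_eq0 -[RHS]subr_eq0.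
  have -> : (x * 2%:R - u) ^+ 2 - (u ^+ 2 - 4%:R) = 4%:R * x * (x + x^-1 - u).
    by field.
  by rewrite !mulf_eq0 (negPf F4) (negPf x0).
transitivity (\sum_(x | x != 0) chi (x + x^-1 + a)).
  rewrite sum_split0 mul0r chi0 add0r; apply: eq_bigr => x x0.
  have -> : x * (x ^+ 2 + a * x + 1) = x ^+ 2 * (x + x^-1 + a) by field.
  by rewrite chiM chi_exp2 // mul1r.
transitivity (\sum_u chi (u + a) * (1 + chi (u ^+ 2 - 4%:R))).
  under [RHS]eq_bigr do rewrite -count mulr_sumr.
  rewrite exchange_big /=; apply: eq_bigr => x x0.
  rewrite (bigD1 (x + x^-1)) //= eqxx mulr1 big1 ?addr0 // => u.
  by rewrite eq_sym => /negPf->; rewrite mulr0.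
under eq_bigr do rewrite mulrDr mulr1 -chiM.
by rewrite big_split /= (sum_translate chi) sum_chi add0r.
Qed.

(** The roots -6, -2, 2 of the isogenous cubic are equally spaced: x := 4x - 2 turns it into 64
    x(x^2 - 1), and 64 is a square. *)
Lemma sum_chi_isogeny6 : \sum_x chi (x * (x ^+ 2 + 6%:R * x + 1)) = phi (-1).
Proof.
have F4 : 4%:R != 0 :> F by rewrite (natrM _ 2 2) mulf_neq0.
have F8 : 8%:R != 0 :> F by rewrite (natrM _ 4 2) mulf_neq0.
rewrite sum_chi_isogeny -(sum_translate _ (- 2%:R)) -(sum_dilate _ F4).
apply: eq_bigr => x _; rewrite -[RHS]mul1r -(chi_exp2 F8) -chiM; congr chi; ring.
Qed.

(** In [F], [chi y] is [y ^+ m]. Expanding the powers gives exponents from m to 3m, among which only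
    2m is a multiple of 2m, so a single coefficient survives. *)
Lemma sum_chi_trinomial : 3%:R != 0 :> F ->
  (\sum_x chi (x * (x ^+ 2 + 6%:R * x + 1)))%:~R =
    - (6%:R ^+ m * (trinom_poly F m).[9%:R^-1]) :> F.
Proof.
move=> F3.
have F4 : 4%:R != 0 :> F by rewrite (natrM _ 2 2) mulf_neq0.
have F9 : 9%:R != 0 :> F by rewrite (natrM _ 3 3) mulf_neq0.
have F6 : 6%:R != 0 :> F by rewrite (natrM _ 3 2) mulf_neq0.
rewrite (horner_coef_wide _ (size_trinom_poly _ _)) mulr_sumr -sumrN rmorph_sum /=.
(* Here [i] counts the factors 1 + x^2 taken in the expansion, and [j] those contributing x^2; the
   exponent is 2m exactly when i = 2j. *)
transitivity (\sum_(j < m.+1) \sum_(i < m.+1) 'C(m, i)%:R * 'C(i, j)%:R *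
    6%:R ^+ (m - i) * \sum_(x : F) x ^+ (m + (m - i) + 2 * j)).
  under [RHS]eq_bigr do under eq_bigr do rewrite mulr_sumr.
  under [RHS]eq_bigr do rewrite exchange_big.
  rewrite exchange_big /=; apply: eq_bigr => x _.
  rewrite intr_chi exprMn addrAC [_ + 1]addrC addrC exprDn mulr_sumr exchange_big /=.
  apply: eq_bigr => i _; rewrite [1 + _]addrC exprD1n.
  rewrite -mulrnAl mulrA mulr_sumr
    (big_ord_widen m.+1 (fun j => x ^+ m * ((6%:R * x) ^+ (m - i) *+ 'C(m, i)) *
       (x ^+ 2 ^+ j *+ 'C(i, j))) (ltn_ord i)) /= big_mkcond /=.
  apply: eq_bigr => j _; case: ltnP => [_|lt_ij]; last first.
    by rewrite (@bin_small i j) // mulr0 !mul0r.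
  rewrite exprMn -[in LHS]exprM exprD [x ^+ (_ + (m - i))]exprD.
  by ring.
apply: eq_bigr => j _; rewrite coef_trinom_poly.
have [le_jm | lt_mj] := leqP j.*2 m; last first.
  rewrite bin_small // !mul0r mulr0 oppr0 big1 // => i _.
  have [lt_ij | le_ji] := ltnP i j; first by rewrite (bin_small lt_ij) mulr0 !mul0r.
  rewrite sum_power; last by have := half_card_gt0; lia.
  rewrite (_ : _ %| _ = false)%N ?oppr0 ?mulr0 //; apply/negP => /dvdnP[k Ek].
  by move: (ltn_ord i) half_card_gt0 Ek; case: k => [|[|k]]; lia.
have lt_jm : (j.*2 < m.+1)%N by [].
rewrite (bigD1 (Ordinal lt_jm)) //= [X in _ + X]big1 ?addr0 => [|i neq_i].
  rewrite sum_power; last by have := half_card_gt0; lia.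
  rewrite (_ : m + (m - j.*2) + 2 * j = m.*2)%N ?dvdnn; last by lia.
  (* Of 36^j = 4^j 9^j, the first factor sits in the coefficients of [trinom_poly], the second comes
     from the point 1/9. *)
  rewrite (_ : 6%:R ^+ m = 6%:R ^+ (m - j.*2) * (4%:R ^+ j * 9%:R ^+ j) :> F).
    have F4j : 4%:R ^+ j != 0 :> F by rewrite expf_neq0.
    have F9j : 9%:R ^+ j != 0 :> F by rewrite expf_neq0.
    rewrite exprVn /=; move: (4%:R ^+ j) (9%:R ^+ j) F4j F9j => c d c0 d0.
    by field; rewrite c0 d0.
  rewrite -exprMn -natrM (natrX _ 6 2 : 36%:R = _) -exprM mul2n -exprD.
  by congr (_ ^+ _); lia.
have [lt_ij | le_ji] := ltnP i j; first by rewrite (bin_small lt_ij) mulr0 !mul0r.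
rewrite sum_power; last by have := half_card_gt0; lia.
rewrite (_ : _ %| _ = false)%N ?oppr0 ?mulr0 //; apply/negP => /dvdnP[k Ek].
case/eqP: neq_i; apply: val_inj => /=; move: (ltn_ord i) half_card_gt0 Ek.
by case: k => [|[|k]]; lia.
Qed.

Lemma chiN1 : chi (-1) = (-1) ^+ m.
Proof.
by have [z zP] := prim_root_ex; rewrite -(prim_root_exp_half zP) (chi_prim_rootX zP).
Qed.

Lemma phi_odd u : odd m -> phi u = 0.
Proof.
move=> odd_m; have N1 : -1 != 0 :> F by rewrite oppr_eq0 oner_eq0.
suff : phi u = - phi u by move: (phi u) => s; lia.
rewrite {1}/phi -(sum_dilate _ N1) -sumrN; apply: eq_bigr => x _.
have -> : x * -1 * ((x * -1) ^+ 2 + u) = -1 * (x * (x ^+ 2 + u)) by ring.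
by rewrite chiM chiN1 -signr_odd odd_m mulN1r.
Qed.

(** Substitute x := t x. Consequently [phi u ^+ 2] depends only on the square class of [u]. *)
Lemma phi_scale u t : t != 0 -> phi (t ^+ 2 * u) = chi t * phi u.
Proof.
move=> t0; rewrite /phi -(sum_dilate _ t0) mulr_sumr; apply: eq_bigr => x _.
have -> : x * t * ((x * t) ^+ 2 + t ^+ 2 * u) = t * (t ^+ 2 * (x * (x ^+ 2 + u))).
  by ring.
by rewrite chiM [chi (t ^+ 2 * _)]chiM chi_exp2 // mul1r.
Qed.

Lemma phi_sqr_prim_rootX z j : m.*2.-primitive_root z ->
  phi (z ^+ j) ^+ 2 = if odd j then phi z ^+ 2 else phi 1 ^+ 2.
Proof.
move=> zP; have z0 := prim_root_neq0 zP.
have step i : phi (z ^+ i.+2) ^+ 2 = phi (z ^+ i) ^+ 2.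
  by rewrite -addn2 addnC exprD phi_scale // exprMn chi_sqr z0 mul1r.
have : phi (z ^+ j) ^+ 2 = phi (z ^+ odd j) ^+ 2.
  rewrite -{1}[j]odd_double_half; elim: (j./2) => [|k IHk]; first by rewrite addn0.
  by rewrite doubleS !addnS step IHk.
by move=> ->; case: odd.
Qed.

(** * Evaluation of [phi 1] when the order of the field is 1 modulo 4 *)

Section MEven.

Hypothesis even_m : ~~ odd m.

Lemma chiN1_even : chi (-1) = 1.
Proof. by rewrite chiN1 -signr_odd (negPf even_m). Qed.

(** Expand the square and sum over [u] first: up to a constant -1, which contributes 0 by [sum_chi],
    only the pairs with y = x or y = -x remain, each with weight [#|F|]. *)
Lemma phi_sqr_sum : \sum_u phi u ^+ 2 = 4 * m%:Z * #|F|%:Z.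
Proof.
have inner x y :
    \sum_u chi ((x ^+ 2 + u) * (y ^+ 2 + u)) = #|F|%:Z * (x ^+ 2 == y ^+ 2)%:R - 1.
  case: eqP => [-> | /eqP neq_xy].
    under eq_bigr do rewrite -expr2.
    rewrite -(sum_translate _ (- y ^+ 2)); under eq_bigr do rewrite addrC subrK.
    rewrite sum_split0 expr0n chi0 add0r.
    under eq_bigr => t t0 do rewrite chi_exp2 //.
    by rewrite sumr_const cardC1 cardF natz mulr1; lia.
  rewrite mulr0 sub0r -(sum_chi_mul neq_xy).
  by apply: eq_bigr => u _; congr (chi (_ * _)); rewrite addrC.
have pair x : \sum_y chi (x * y) * (x ^+ 2 == y ^+ 2)%:R = 2 * (x != 0)%:R.
  have [-> | x0] := eqVneq x 0.
    by rewrite big1 ?mulr0 // => y _; rewrite mul0r chi0 mul0r.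
  have xN : x != - x by rewrite -subr_eq0 opprK -mulr2n -mulr_natr mulf_neq0.
  rewrite (bigD1 x) //= eqxx (bigD1 (- x)) /=; last by rewrite eq_sym.
  rewrite sqrrN eqxx big1 => [|y /andP[yx yNx]].
    by rewrite mulrN -mulN1r [chi (-1 * _)]chiM chiN1_even -expr2 chi_exp2.
  by rewrite eq_sym eqf_sqr (negPf yx) (negPf yNx) mulr0.
transitivity (\sum_x \sum_y chi (x * y) * (#|F|%:Z * (x ^+ 2 == y ^+ 2)%:R - 1)).
  under [RHS]eq_bigr do under eq_bigr do rewrite -inner mulr_sumr.
  under [RHS]eq_bigr do rewrite exchange_big.
  rewrite exchange_big /=; apply: eq_bigr => u _.
  rewrite expr2 /phi mulr_suml; apply: eq_bigr => x _.
  rewrite mulr_sumr; apply: eq_bigr => y _; rewrite -!chiM; congr chi; ring.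
transitivity (#|F|%:Z * \sum_x \sum_y chi (x * y) * (x ^+ 2 == y ^+ 2)%:R
    - (\sum_x chi x) * \sum_y chi y).
  rewrite mulr_sumr mulr_suml -sumrB; apply: eq_bigr => x _.
  rewrite !mulr_sumr -sumrB; apply: eq_bigr => y _; rewrite chiM; ring.
rewrite sum_chi mul0r subr0; under eq_bigr do rewrite pair.
rewrite -mulr_sumr sum_split0 eqxx add0r.
under eq_bigr => x x0 do rewrite x0.
by rewrite sumr_const cardC1 cardF; lia.
Qed.

(** Among the 2m nonzero [u], half are squares and half are not, and [phi 0 = 0]; so the second
    moment is m times the left side. *)
Lemma phi_sqr_add z : m.*2.-primitive_root z ->
  phi 1 ^+ 2 + phi z ^+ 2 = 4 * #|F|%:Z.
Proof.
move=> zP; have := phi_sqr_sum; rewrite sum_split0 (sum_prim_rootX zP).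
have -> : phi 0 = 0.
  apply: etrans sum_chi; apply: eq_bigr => x _; rewrite addr0.
  have [-> | x0] := eqVneq x 0; first by rewrite mul0r.
  by rewrite chiM chi_exp2 // mulr1.
have alt k : \sum_(0 <= j < k.*2) phi (z ^+ j) ^+ 2 =
    k%:Z * (phi 1 ^+ 2 + phi z ^+ 2).
  elim: k => [|k IHk]; first by rewrite big_nil mul0r.
  rewrite doubleS !big_nat_recr //= IHk !(phi_sqr_prim_rootX _ zP) /= odd_double /=.
  by rewrite intS; ring.
rewrite expr0n /= add0r alt; have := half_card_gt0.
move: (phi 1 ^+ 2 + _) => s m0; rewrite mulrAC [4 * _ * _]mulrC => /mulfI; apply.
lia.
Qed.

Lemma sqrtN1_chi : exists2 i, i ^+ 2 = -1 & chi i = (-1) ^+ m./2.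
Proof.
have [z zP] := prim_root_ex; exists (z ^+ m./2); last exact: chi_prim_rootX.
by rewrite -exprM muln2 even_halfK ?(prim_root_exp_half zP).
Qed.

(** From (1 + i)^2 = 2i, [chi 2] equals [chi i]. *)
Lemma chi2_even : chi 2%:R = (-1) ^+ m./2.
Proof.
have [i i2 chi_i] := sqrtN1_chi.
have i10 : 1 + i != 0.
  rewrite addrC addr_eq0; apply/eqP => iN; move/eqP: i2.
  by rewrite iN sqrrN expr1n eq_sym neqN11.
have : chi (2%:R * i) = 1.
  by rewrite -(chi_exp2 i10); congr chi; rewrite sqrrD i2; ring.
rewrite chiM chi_i -signr_odd; move: (chi _) => c.
by case: odd; rewrite ?expr1 ?expr0; lia.
Qed.

Lemma phiN1 : phi (-1) = chi 2%:R * phi 1.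
Proof.
have [i i2 chi_i] := sqrtN1_chi; rewrite chi2_even -chi_i -[-1]mulr1 -i2 phi_scale //.
by apply: contraTneq (oner_neq0 F) => i0; rewrite -oppr_eq0 -i2 i0 expr0n eqxx.
Qed.

(** The summand is invariant under x := -x ([f_shift]) and x := -1/x ([f_refl]). It is [chi 2] at 1
    and -1, and 0 at the square roots of -1; the other points form q - 1 orbits of size 4. *)
Lemma phi1_mod8 : exists2 A, phi 1 = 2 * A & (4 %| A + 1)%Z.
Proof.
have [z zP] := prim_root_ex; have z0 := prim_root_neq0 zP.
pose q := m./2; have Em : m = q.*2 by rewrite even_halfK.
have q0 : (0 < q)%N by have := half_card_gt0; lia.
pose f j := chi (z ^+ j * ((z ^+ j) ^+ 2 + 1)).
have zq : (z ^+ q) ^+ 2 = -1 by rewrite -exprM muln2 -Em (prim_root_exp_half zP).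
have f_shift j : f (j + m)%N = f j.
  rewrite /f exprD (prim_root_exp_half zP).
  have -> : z ^+ j * -1 * ((z ^+ j * -1) ^+ 2 + 1) =
    -1 * (z ^+ j * ((z ^+ j) ^+ 2 + 1)) by ring.
  by rewrite [chi (-1 * _)]chiM chiN1_even mul1r.
have f_refl i : (i <= m)%N -> f (m - i)%N = f i.
  move=> le_im; rewrite /f.
  have : z ^+ (m - i) * z ^+ i = -1 by rewrite -exprD subnK // (prim_root_exp_half zP).
  have y0 : z ^+ i != 0 by rewrite expf_neq0.
  move: (z ^+ i) y0 => y y0 h; have -> : z ^+ (m - i) = - y^-1.
    by apply: (mulIf y0); rewrite h; field.
  have -> : - y^-1 * ((- y^-1) ^+ 2 + 1) = -1 * ((y^-1 ^+ 2) ^+ 2 * (y * (y ^+ 2 + 1))).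
    by field.
  by rewrite [chi (-1 * _)]chiM chiN1_even mul1r [LHS]chiM chi_exp2 ?mul1r // expf_neq0 ?invr_eq0.
have fq : f q = 0 by rewrite /f zq addNr mulr0 chi0.
have f0 : f 0%N = chi 2%:R by rewrite /f expr0; congr chi; ring.
have Ephi : phi 1 = 2 * (chi 2%:R + 2 * \sum_(1 <= j < q) f j).
  rewrite /phi sum_split0 mul0r chi0 add0r (sum_prim_rootX zP).
  rewrite -/f -addnn (big_cat_nat (n := m)) //= ?leq_addr //.
  rewrite -{2}[m]add0n big_addn addnK.
  under [X in _ + X]eq_bigr do rewrite -/(f _) f_shift.
  rewrite -[X in X + _]/(\sum_(0 <= j < m) f j).
  have -> : \sum_(0 <= j < m) f j = chi 2%:R + 2 * \sum_(1 <= j < q) f j.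
    rewrite (big_cat_nat (n := q)) //=; last by lia.
    rewrite big_ltn // f0 [X in _ + X]big_ltn ?fq ?add0r; last by lia.
    rewrite -{1}[q.+1]add1n big_addn.
    have -> : (m - q = q)%N by lia.
    rewrite [X in _ + X = _]big_nat_rev /=.
    have -> : \sum_(1 <= i < q) f (1 + q - i.+1 + q)%N = \sum_(1 <= i < q) f i.
      rewrite !big_nat; apply: eq_bigr => i lt_i; rewrite -f_refl; last by lia.
      by congr f; lia.
    by ring.
  by ring.
exists (chi 2%:R + 2 * \sum_(1 <= j < q) f j) => //.
have f1 j : (1 <= j < q)%N -> (2 %| f j - 1)%Z.
  move=> lt_j; rewrite /f chi_eq; first by case: ifP.
  rewrite mulf_neq0 ?expf_neq0 // addr_eq0 -(prim_root_exp_half zP) -exprM.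
  by rewrite (eq_prim_root_expr zP) !modn_small; lia.
(* A sum of q - 1 signs has the parity of q - 1. With chi 2 = (-1)^q this gives chi 2 + 2(q - 1) =
   -1 modulo 4. *)
have : (2 %| \sum_(1 <= j < q) f j - (q%:Z - 1))%Z.
  have -> : q%:Z - 1 = \sum_(1 <= j < q) 1.
    by rewrite sumr_const_nat natz; lia.
  by rewrite -sumrB big_nat; apply: rpred_sum => j /f1.
rewrite chi2_even -/q -signr_odd; move: (\sum_(1 <= j < q) f j) => s.
by case: (boolP (odd q)) => /=; lia.
Qed.

(** Halving both terms of [phi_sqr_add] gives [#|F|] as A^2 + B^2 with A odd and B even. Uniqueness
    yields a = A or a = -A, and the residues modulo 4 select the latter. *)
Lemma phi1_two_squares (a b : int) : prime #|F| ->
  #|F|%:Z = a ^+ 2 + b ^+ 2 -> (4 %| a - 1)%Z -> phi 1 = - (2 * a).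
Proof.
move=> p_pr Eab a1; have [z zP] := prim_root_ex.
have [A phiA A1] := phi1_mod8; have := phi_sqr_add zP.
rewrite phiA; move: (phi z) => s Es.
have [B EB] : exists B, s = 2 * B.
  have : (2 %| s)%Z.
    have : (2 %| s ^+ 2)%Z.
      apply/dvdzP; exists (2 * #|F|%:Z - 2 * A ^+ 2).
      rewrite (_ : s ^+ 2 = 4 * #|F|%:Z - (2 * A) ^+ 2); first by ring.
      by rewrite -Es addrC addKr.
    by rewrite !dvdzE abszX Euclid_dvdX // => /andP[].
  by case/dvdzP => B ->; exists B; rewrite mulrC.
have EAB : #|F|%:Z = A ^+ 2 + B ^+ 2 by apply: (@mulfI _ 4) => //; rewrite -Es EB; ring.
have even_B : (2 %| B)%Z.
  have : (2 %| B ^+ 2)%Z.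
    case/dvdzP: A1 => t Et; have EA : A = t * 4 - 1 by rewrite -Et addrK.
    (* Half of 2m + 1 - (4t - 1)^2. *)
    apply/dvdzP; exists (m%:Z - 8 * t ^+ 2 + 4 * t).
    have -> : B ^+ 2 = #|F|%:Z - A ^+ 2 by rewrite EAB addrC addKr.
    by rewrite cardF EA -muln2 intS PoszM; ring.
  by rewrite !dvdzE abszX Euclid_dvdX // => /andP[].
case: (two_squares_unique p_pr Eab EAB) => /eqP;
  rewrite eqf_sqr => /orP[]/eqP E; move: a1 A1 even_B E; clear; lia.
Qed.

(** -3 is a square exactly when [F] has a primitive cube root of unity w, through -3 = (2w + 1)^2;
    and -1 is a square here. *)
Lemma chi3_even : 3%:R != 0 :> F -> chi 3%:R = if (3 %| m)%N then 1 else -1.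
Proof.
move=> F3; have [z zP] := prim_root_ex; have z0 := prim_root_neq0 zP.
have -> : chi 3%:R = chi (- 3%:R) by rewrite -[in RHS]mulN1r chiM chiN1_even mul1r.
have F3N : - 3%:R != 0 :> F by rewrite oppr_eq0.
case: ifP => [/dvdnP[k Ek] | ndvd].
  pose w := z ^+ k.*2.
  have w3 : w ^+ 3 = 1 by rewrite -exprM (_ : k.*2 * 3 = m.*2)%N ?(prim_expr_order zP) //; lia.
  have w1 : w - 1 != 0.
    rewrite subr_eq0 -(prim_order_dvd zP); apply/negP => /dvdn_leq.
    by have := half_card_gt0; lia.
  have w2 : w ^+ 2 + w + 1 = 0.
    apply: (mulfI w1); rewrite mulr0; transitivity (w ^+ 3 - 1); first by ring.
    by rewrite w3 subrr.
  have E : - 3%:R = (2%:R * w + 1) ^+ 2.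
    transitivity (4%:R * (w ^+ 2 + w + 1) - 3%:R); first by rewrite w2 mulr0 add0r.
    by ring.
  rewrite E chi_exp2 //; apply: contraNneq F3N => w0; rewrite E w0; apply/eqP; ring.
rewrite /chi (negPf F3N); case: ifP => // chi31.
have [j _ Ej] := prim_root_log zP F3N.
have odd_j : ~~ odd j.
  have : chi (- 3%:R) = 1 by rewrite /chi (negPf F3N) chi31.
  by rewrite Ej (chi_prim_rootX zP) -signr_odd; case: odd.
pose t := z ^+ j./2; have t2 : t ^+ 2 = - 3%:R by rewrite -exprM muln2 even_halfK.
pose w := (t - 1) / 2%:R.
have w2 : w ^+ 2 + w + 1 = 0.
  transitivity ((t ^+ 2 + 3%:R) / 4%:R); last by rewrite t2 addNr mul0r.
  have F4 : 4%:R != 0 :> F by rewrite (natrM _ 2 2) mulf_neq0.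
  by rewrite /w; field; rewrite F2 F4.
have w3 : w ^+ 3 = 1.
  transitivity (1 + (w - 1) * (w ^+ 2 + w + 1)); first by ring.
  by rewrite w2 mulr0 addr0.
have w1 : w != 1.
  apply: contraNneq F3 => w1; rewrite -w2 w1; apply/eqP; ring.
have w0 : w != 0.
  by apply: contraNneq (oner_neq0 F) => w0; rewrite -w3 w0 expr0n.
(* The order of [w] divides both 3 and [m.*2], which are coprime, against [w != 1]. *)
have := expf_card_pred w0.
rewrite (divn_eq m.*2 3) exprD mulnC exprM w3 expr1n mul1r.
have : (m.*2 %% 3 = 1 \/ m.*2 %% 3 = 2)%N by move: ndvd; clear; lia.
case=> -> => [/eqP|] h; first by rewrite expr1 (negPf w1) in h.
by move: w3; rewrite exprS h mulr1 => /eqP; rewrite (negPf w1).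
Qed.

End MEven.

(** [6 ^ m] is the sign [chi 6], its own inverse. *)
Lemma trinom_poly_phi : 3%:R != 0 :> F ->
  (trinom_poly F m).[9%:R^-1] = - (chi 6%:R * phi (-1))%:~R.
Proof.
move=> F3; have F6 : 6%:R != 0 :> F by rewrite (natrM _ 3 2) mulf_neq0.
have := sum_chi_trinomial F3; rewrite sum_chi_isogeny6 => E.
by rewrite intrM E mulrN opprK -intr_chi mulrA -intrM -expr2 chi_sqr F6 mul1r.
Qed.

Lemma trinom_poly_odd_m : 3%:R != 0 :> F -> odd m ->
  (trinom_poly F m).[9%:R^-1] = 0.
Proof. by move=> F3 odd_m; rewrite trinom_poly_phi // phi_odd // mulr0 oppr0. Qed.

(** The two factors [chi 2], one from [chi 6] and one from [phiN1], cancel and leave [chi 3]. *)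
Lemma trinom_poly_even_m (a b : int) : 3%:R != 0 :> F -> ~~ odd m ->
  prime #|F| -> #|F|%:Z = a ^+ 2 + b ^+ 2 -> (4 %| a - 1)%Z ->
  (trinom_poly F m).[9%:R^-1] = (2 * (if (3 %| m)%N then 1 else -1) * a)%:~R.
Proof.
move=> F3 even_m F_pr Eab a1; rewrite trinom_poly_phi // phiN1 //.
rewrite (phi1_two_squares even_m F_pr Eab a1) -chi3_even // -rmorphN; congr _%:~R.
transitivity (chi 2%:R ^+ 2 * (2 * chi 3%:R * a)); last by rewrite chi_sqr F2 mul1r.
by rewrite (natrM F 3 2) chiM; ring.
Qed.

End QuadraticCharacter.

Lemma legendre3 p : ~~ (3 %| p)%N -> legendre p%:Z 3 = if (p %% 3 == 1)%N then 1 else -1.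
Proof.
move=> ndvd; rewrite /legendre dvdzE /= (negPf ndvd).
case: ifP => [/existsP[x] | /negbT/existsPn h].
  by case: eqP => // p1; case: x => [[|[|[|x]]]] //= _; lia.
case: eqP => // p1; have := h (Ordinal (isT : (1 < 3)%N)).
by rewrite /=; lia.
Qed.

(** * Reduction of rationals modulo [p] *)

Section Reduction.

Variables (F : fieldType) (p : nat).
Hypothesis pF : p \in [pchar F].

(** Graph of the reduction map. Fractions need not be in lowest terms, which makes stability under
    sums and products direct. *)
Definition reduces (x : rat) (y : F) : Prop :=
  exists n d : int, [/\ d%:~R != 0 :> F, x = n%:~R / d%:~R & y = n%:~R / d%:~R].

Lemma intr_neq0_rat (d : int) : d%:~R != 0 :> F -> d%:~R != 0 :> rat.
Proof. by rewrite intr_eq0; apply: contraNneq => ->. Qed.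

Lemma reduces_int n : reduces n%:~R n%:~R.
Proof. by exists n, 1; rewrite !divr1 oner_neq0. Qed.

Lemma reduces_nat n : reduces n%:R n%:R.
Proof. by rewrite !pmulrn; exact: reduces_int. Qed.

Lemma reducesD x x' y y' : reduces x y -> reduces x' y' -> reduces (x + x') (y + y').
Proof.
move=> [n [d [d0 -> ->]]] [n' [d' [d'0 -> ->]]].
exists (n * d' + n' * d), (d * d'); rewrite !(intrD, intrM) mulf_neq0 //.
have e0 := intr_neq0_rat d0; have e'0 := intr_neq0_rat d'0.
by split=> //; field; rewrite ?d0 ?d'0 ?e0 ?e'0.
Qed.

Lemma reducesM x x' y y' : reduces x y -> reduces x' y' -> reduces (x * x') (y * y').
Proof.
move=> [n [d [d0 -> ->]]] [n' [d' [d'0 -> ->]]].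
exists (n * n'), (d * d'); rewrite !intrM mulf_neq0 //.
by split=> //; rewrite invfM mulrACA.
Qed.

Lemma reducesV x y : y != 0 -> reduces x y -> reduces x^-1 y^-1.
Proof.
move=> y0 [n [d [d0 Ex Ey]]]; exists d, n; rewrite Ex {1}Ey !invf_div; split=> //.
by apply: contraNneq y0; rewrite Ey => ->; rewrite mul0r.
Qed.

Lemma reducesX x y k : reduces x y -> reduces (x ^+ k) (y ^+ k).
Proof.
move=> xy; elim: k => [|k IHk]; first exact: reduces_int 1.
by rewrite !exprS; apply: reducesM.
Qed.

Lemma reduces_sum (r : seq nat) (f : nat -> rat) (g : nat -> F) :
  (forall k, reduces (f k) (g k)) -> reduces (\sum_(k <- r) f k) (\sum_(k <- r) g k).
Proof.
by move=> fg; apply: (big_rec2 reduces); [exact: reduces_int 0 | move=> k x y _; exact: reducesD].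
Qed.

Lemma dvdz_intr (d : int) : (p%:Z %| d)%Z = (d%:~R == 0 :> F).
Proof.
by rewrite dvdzE (dvdn_pcharf pF) {2}[d]intEsign rmorphMsign mulf_eq0 signr_eq0.
Qed.

(** The reduced denominator divides any other denominator, hence is nonzero in [F] too; in
    particular [y] is determined by [x]. *)
Lemma reduces_numden x y : reduces x y ->
  (denq x)%:~R != 0 :> F /\ y = (numq x)%:~R / (denq x)%:~R.
Proof.
move=> [n [d [d0 Ex ->]]]; have e0 := intr_neq0_rat d0.
have E : numq x * d = n * denq x.
  apply/eqP; rewrite -(eqr_int rat) !intrM; apply/eqP.
  by rewrite numqE {1}Ex; field.
have dvd_d : (denq x %| d)%Z.
  by rewrite -(@Gauss_dvdzr _ (numq x)) ?E ?dvdz_mull // coprimez_sym; apply: coprime_num_den.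
have q0 : (denq x)%:~R != 0 :> F.
  by apply: contraNneq d0 => /eqP; rewrite -!dvdz_intr => /dvdz_trans->.
split=> //; apply/eqP; rewrite eqr_div // -!intrM -E mulrC //.
Qed.

Lemma pintegral_reduces x y : prime p -> reduces x y -> pintegral p x.
Proof.
move=> p_pr /reduces_numden[d0 _].
by rewrite /pintegral coprimez_sym coprimezE prime_coprime // -dvdzE dvdz_intr.
Qed.

Lemma eqmodq_reduces x x' y : prime p -> reduces x y -> reduces x' y -> eqmodq p x x'.
Proof.
move=> p_pr xy x'y; rewrite /eqmodq (pintegral_reduces p_pr xy) (pintegral_reduces p_pr x'y).
have := reducesD xy (reducesM (reduces_int (-1)) x'y).
rewrite !mulN1r subrr => /reduces_numden[d0 /esym/eqP].
by rewrite mulf_eq0 invr_eq0 (negPf d0) orbF -dvdz_intr.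
Qed.

End Reduction.

(** * Residues of [p] modulo 8 and the three cases *)

Theorem theorem5p12 (p : nat) (p_prime : prime p) (p_gt7 : (7 < p)%N) :
  let S : rat :=
    \sum_(0 <= k < (p %/ 8).+1)
       'C(p %/ 8, k)%:R * 'C((3 * p) %/ 8, k)%:R * (32%:R / 81%:R) ^+ k in
  [/\ (forall a b : int,
         p%:Z = a ^+ 2 + b ^+ 2 -> (p = 1 %[mod 8])%N -> (4 %| a - 1)%Z ->
         eqmodq p S ((legendre p%:Z 3)%:~R * (2%:R * a%:~R))),
      (forall a b : int,
         p%:Z = a ^+ 2 + b ^+ 2 -> (p = 5 %[mod 8])%N -> (4 %| a - 1)%Z ->
         eqmodq p S (18%:R / 7%:R * (legendre p%:Z 3)%:~R * a%:~R))
    & ((p = 3 %[mod 4])%N -> eqmodq p S 0)].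
Proof.
set n := (p %/ 8)%N; set N := ((3 * p) %/ 8)%N => S.
have [F card_p pF] : exists2 F : finFieldType, #|F| = p & p \in [pchar F].
  by exists 'F_p; [exact: card_Fp | exact: pchar_Fp].
pose m := p./2.
have odd_p : odd p by case: (even_prime p_prime) => // p2; move: p_gt7; rewrite p2.
have cardF : #|F| = m.*2.+1 by rewrite card_p -[LHS]odd_double_half odd_p.
have natF_neq0 k : (0 < k < p)%N -> k%:R != 0 :> F.
  by move=> /andP[k0 k_lt]; rewrite -(dvdn_pcharf pF) gtnNdvd.
have F2 : 2%:R != 0 :> F by apply: natF_neq0; lia.
have F3 : 3%:R != 0 :> F by apply: natF_neq0; lia.
have F4 : 4%:R != 0 :> F by apply: natF_neq0; lia.
have F7 : 7%:R != 0 :> F by apply: natF_neq0; lia.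
have F81 : 81%:R != 0 :> F by rewrite (natrX _ 3 4) expf_neq0.
have pE : p = m.*2.+1 by rewrite -cardF card_p.
have p0 : p%:R = 0 :> F by apply/eqP; rewrite -(dvdn_pcharf pF).
have m2 : 2%:R * m%:R = -1 :> F.
  by apply/eqP; rewrite -subr_eq0 opprK -natrM mul2n natr1 -pE p0.
have redS : reduces S (bin_poly F n N).[32%:R / 81%:R].
  rewrite horner_bin_poly; apply: reduces_sum => k.
  apply/reducesM/reducesX/reducesM/reducesV; rewrite //; try exact: reduces_nat.
  by apply: reducesM; exact: reduces_nat.
have nat_mod k s t : (8 * k + s = t * p)%N -> 8%:R * k%:R + s%:R = 0 :> F.
  by move=> E; rewrite -natrM -natrD E natrM p0 mulr0.
(* With [s], [t] the residues of p and 3p modulo 8, 8n = -s and 8N = -t in [F]. The pairs {1, 3} and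
   {5, 7} yield the hypotheses of the even and odd transformations. *)
have sums s t c : (8 * n + s = p)%N -> (8 * N + t = 3 * p)%N -> (s + t = 4 * c)%N ->
    2%:R * (n%:R + N%:R) = - c%:R :> F /\ 64%:R * n%:R * N%:R = (s * t)%:R :> F.
  move=> En EN Ec; have hn := nat_mod n s 1%N; have hN := nat_mod N t 3%N.
  rewrite mul1n in hn; move: (hn En) (hN EN) => {}hn {}hN.
  have hs : s%:R = - (8%:R * n%:R) :> F by apply/eqP; rewrite -addr_eq0 addrC hn.
  have ht : t%:R = - (8%:R * N%:R) :> F by apply/eqP; rewrite -addr_eq0 addrC hN.
  have hc : s%:R + t%:R = 4%:R * c%:R :> F by rewrite -natrD Ec natrM.
  split; last by rewrite natrM hs ht; ring.
  by apply: (mulfI F4); rewrite mulrN -hc hs ht; ring.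
have lt_mp : (m < p)%N by rewrite pE; clear; lia.
have lt_np : ((2 * n).+1 < p)%N by move: p_gt7; rewrite /n; clear; lia.
have divp8 r : (p %% 8 = r)%N -> (8 * n + r = p)%N.
  by move=> <-; rewrite mulnC -divn_eq.
have div3p8 r s : (p %% 8 = r)%N -> (3 * r %% 8 = s)%N -> (8 * N + s = 3 * p)%N.
  by move=> <- <-; rewrite modnMmr mulnC -divn_eq.
have odd_m : odd m = odd (p %% 8)./2 by rewrite /m; clear; lia.
have S_even s t : (8 * n + s = p)%N -> (8 * N + t = 3 * p)%N -> (s + t = 4)%N ->
    (s * t = 3)%N -> (bin_poly F n N).[32%:R / 81%:R] = (trinom_poly F m).[9%:R^-1].
  move=> En EN E4 E3; have [h1 h2] := sums s t 1%N En EN E4; rewrite E3 in h2.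
  by apply: (bin_poly_value_even pF) => //; apply: ltnW.
have S_odd s t : (8 * n + s = p)%N -> (8 * N + t = 3 * p)%N -> (s + t = 12)%N ->
    (s * t = 35)%N ->
    7%:R * (bin_poly F n N).[32%:R / 81%:R] = 9%:R * (trinom_poly F m).[9%:R^-1].
  move=> En EN E12 E35; have [h1 h2] := sums s t 3%N En EN E12; rewrite E35 in h2.
  by apply: (bin_poly_value_odd pF).
have ndvd3 : ~~ (3 %| p)%N by rewrite dvdn_prime2 //; apply: contraTneq p_gt7 => <-.
(* As p = 2m + 1 is prime to 3, 3 divides m exactly when p = 1 modulo 3; this matches the sign in
   [chi3_even]. *)
have L : legendre p%:Z 3 = if (3 %| m)%N then 1 else -1.
  rewrite legendre3 //; congr (if _ then _ else _).
  by move: ndvd3; rewrite pE; clear; lia.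
have value a b : p%:Z = a ^+ 2 + b ^+ 2 -> ~~ odd m -> (4 %| a - 1)%Z ->
    (trinom_poly F m).[9%:R^-1] = (2 * legendre p%:Z 3 * a)%:~R.
  rewrite L => Eab even_m a1.
  by apply: (trinom_poly_even_m cardF F2 (b := b)) => //; rewrite card_p.
split=> [a b Eab p1 a1 | a b Eab p5 a1 | p3].
- apply: (eqmodq_reduces pF p_prime redS).
  rewrite (S_even 1%N 3%N) ?(divp8 1%N) ?(div3p8 1%N 3%N) //.
  rewrite (value _ _ Eab) ?odd_m ?p1 //.
  have -> : (legendre p 3)%:~R * (2%:R * a%:~R) = (2 * legendre p 3 * a)%:~R :> rat.
    by rewrite !intrM; ring.
  exact: reduces_int.
- apply: (eqmodq_reduces pF p_prime redS).
  have E : 7%:R * (bin_poly F n N).[32%:R / 81%:R] = 9%:R * (2 * legendre p 3 * a)%:~R.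
    rewrite (S_odd 5%N 7%N) ?(divp8 5%N) ?(div3p8 5%N 7%N) //.
    by rewrite (value _ _ Eab) ?odd_m ?p5.
  (* 18/7 is 2 times 9/7, the inverse of 1 - 2z at z = 1/9. *)
  have -> : (bin_poly F n N).[32%:R / 81%:R] =
     18%:R / 7%:R * (legendre p 3)%:~R * a%:~R.
    by apply: (mulfI F7); rewrite E !intrM; field.
  do 2!(apply: reducesM; last exact: reduces_int).
  by apply/reducesM/reducesV => //; exact: reduces_nat.
apply: (eqmodq_reduces pF p_prime redS).
have p8 : (p %% 8 = 3 \/ p %% 8 = 7)%N by move: p3; clear; lia.
have T0 : (trinom_poly F m).[9%:R^-1] = 0.
  by apply: (trinom_poly_odd_m cardF) => //; rewrite odd_m; case: p8 => ->.
(* Residue 3 falls under the even transformation and residue 7 under the odd one, with the roles of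
   [s] and [t] swapped. *)
have -> : (bin_poly F n N).[32%:R / 81%:R] = 0.
  case: p8 => p8.
    by rewrite (S_even 3%N 1%N) ?(divp8 3%N) ?(div3p8 3%N 1%N).
  apply: (mulfI F7).
  by rewrite (S_odd 7%N 5%N) ?(divp8 7%N) ?(div3p8 7%N 5%N) // T0 !mulr0.
exact: reduces_int 0.
Qed.
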